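(* Let all data be as described in the context, with $\lambda_j\ge 0$ and $\theta_j>0$ (entrywise) for $j=1,\dots,N$. Define $$\Sigma_j=\begin{cases} D_N & \text{for } j=N,\\ D_j-\Upsilon_{j+1}^\top\Sigma_{j+1}^{-1}\Upsilon_{j+1} & \text{for } j=N-1,\dots,1.\end{cases}$$ Then each $\Sigma_j\in\mathbb{R}^{d_j\times d_j}$, where $d_j=(2n_j+2\nu_j)(T+1)+m_jT$, is non-singular (so that the recursion is well defined), and the block tridiagonal linear system $$\begin{bmatrix} D_1 & -\Upsilon_2^\top & 0 & \cdots & 0\\ -\Upsilon_2 & D_2 & -\Upsilon_3^\top & \ddots & \vdots\\ 0 & -\Upsilon_3 & \ddots & \ddots & 0\\ \vdots & \ddots & \ddots & D_{N-1} & -\Upsilon_N^\top\\ 0 & \cdots & 0 & -\Upsilon_N & D_N\end{bmatrix}\begin{bmatrix}\delta_1\\ \delta_2\\ \vdots\\ \vdots\\ \delta_N\end{bmatrix}=\begin{bmatrix}\rho_1\\ \rho_2\\ \vdots\\ \vdots\\ \rho_N\end{bmatrix}$$ has a unique solution, which is given by the backward recursion $$\tilde\rho_j=\begin{cases}\rho_N & \text{for } j=N,\\ \rho_j+\Upsilon_{j+1}^\top\Sigma_{j+1}^{-1}\tilde\rho_{j+1} & \text{for } j=N-1,\dots,1,\end{cases}$$ followed by the forward recursion $$\delta_j=\begin{cases}\Sigma_1^{-1}\tilde\rho_1 & \text{for } j=1,\\ \Sigma_j^{-1}(\tilde\rho_j+\Upsilon_j\delta_{j-1}) & \text{for } j=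2,\dots,N.\end{cases}$$
   Context: Problem data. $N,T\in\mathbb{N}$ (positive integers). For $j=1,\dots,N$ there are positive integers $n_j,m_j,\nu_j$ and real matrices/vectors: $A_j(t)\in\mathbb{R}^{n_j\times n_j}$, $B_j(t)\in\mathbb{R}^{n_j\times m_j}$, $E_j(t)\in\mathbb{R}^{n_j\times n_{j-1}}$ for $t=0,\dots,T-1$ (with $E_1(t)=0$); $Q_j(t)\in\mathbb{R}^{n_j\times n_j}$, $M_j(t)\in\mathbb{R}^{\nu_j\times n_j}$, $c_j(t)\in\mathbb{R}^{\nu_j}$ for $t=0,\dots,T$; $R_j(t)\in\mathbb{R}^{m_j\times m_j}$, $S_j(t)\in\mathbb{R}^{m_j\times n_j}$, $L_j(t)\in\mathbb{R}^{\nu_j\times m_j}$ for $t=0,\dots,T-1$; and $\xi_j\in\mathbb{R}^{n_j}$. Assumptions: for $t=0,\dots,T-1$, $R_j(t)=R_j(t)^\top\succ 0$ and $\begin{bmatrix}Q_j(t)&S_j(t)^\top\\ S_j(t)&R_j(t)\end{bmatrix}\succeq 0$ (symmetric); $Q_j(T)=Q_j(T)^\top\succeq 0$; $M_j(0)=0$. Stacked matrices (blocks indexed by time): - $\hat A_j\in\mathbb{R}^{n_j(T+1)\times n_j(T+1)}$ is block lower bidiagonal with identity blocks on the block diagonal and $-A_j(0),\dots,-A_j(T-1)$ on the first block subdiagonal. - $\hat E_j\in\mathbb{R}^{n_j(T+1)\times n_{j-1}(T+1)}$ has $E_j(0),\dots,E_j(T-1)$ on the first block subdiagonal and zeros elsewhere;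 $\hat E_1=0$. - $\hat B_j=\begin{bmatrix}0\\ \mathrm{diag}(B_j(0),\dots,B_j(T-1))\end{bmatrix}\in\mathbb{R}^{n_j(T+1)\times m_jT}$ (first block row zero). - $\hat H_j=\begin{bmatrix}I&0&\cdots&0\end{bmatrix}^\top\in\mathbb{R}^{n_j(T+1)\times n_j}$. - $\hat Q_j=\mathrm{diag}(Q_j(0),\dots,Q_j(T))$, $\hat R_j=\mathrm{diag}(R_j(0),\dots,R_j(T-1))$, $\hat S_j=\begin{bmatrix}\mathrm{diag}(S_j(0),\dots,S_j(T-1))&0\end{bmatrix}\in\mathbb{R}^{m_jT\times n_j(T+1)}$, $\hat M_j=\mathrm{diag}(M_j(0),\dots,M_j(T))\in\mathbb{R}^{\nu_j(T+1)\times n_j(T+1)}$, $\hat L_j=\begin{bmatrix}\mathrm{diag}(L_j(0),\dots,L_j(T-1))\\0\end{bmatrix}\in\mathbb{R}^{\nu_j(T+1)\times m_jT}$, $\hat c_j=[c_j(0)^\top\cdots c_j(T)^\top]^\top$. Current iterate. $s_j=[\hat x_j^\top\ \hat u_j^\top\ p_j^\top\ \lambda_j^\top\ \theta_j^\top]^\top$ with $\hat x_j,p_j\in\mathbb{R}^{n_j(T+1)}$, $\hat u_j\in\mathbb{R}^{m_jT}$, $\lambda_j,\theta_j\in\mathbb{R}^{\nu_j(T+1)}$. $\Lambda_j$ and $\Theta_j$ are the diagonal matrices with the entries of $\lambda_j$ and $\theta_j$, respectively, on the diagonal. Matrices of the linear system: $$D_j=\begin{bmatrix}\hat Q_j&\hat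 S_j^\top&-\hat A_j^\top&\hat M_j^\top&0\\ \hat S_j&\hat R_j&\hat B_j^\top&\hat L_j^\top&0\\ -\hat A_j&\hat B_j&0&0&0\\ \hat M_j&\hat L_j&0&0&I\\ 0&0&0&\Theta_j&\Lambda_j\end{bmatrix},$$ and $\Upsilon_j$ ($j=2,\dots,N$) is the $5\times5$ block matrix, with row blocks partitioned as $s_j$ and column blocks partitioned as $s_{j-1}$, whose only nonzero block is $-\hat E_j$ in block position $(3,1)$. Right-hand side: $$\rho_j=-\Upsilon_js_{j-1}+D_js_j-\Upsilon_{j+1}^\top s_{j+1}+[0^\top\ 0^\top\ (\hat H_j\xi_j)^\top\ \hat c_j^\top\ \sigma_j^\top]^\top,$$ where the term $\Upsilon_1s_0$ and the term $\Upsilon_{N+1}^\top s_{N+1}$ are taken to be zero, $\sigma_j=-\Theta_j\lambda_j-\Lambda_j\theta_j+\Lambda_j\Theta_j\mathbf 1-\bar\sigma\mu\mathbf 1$, $\mathbf 1$ is the all-ones column vector, $\bar\sigma\in(0,1)$, and $\mu=\big(\sum_{j=1}^N\lambda_j^\top\theta_j\big)/\big(\sum_{j=1}^N\nu_j\big)$. *)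

(* Defs.v *)
From mathcomp Require Import all_boot all_order all_algebra.
From mathcomp Require Import reals.

Set Implicit Arguments.
Unset Strict Implicit.
Unset Printing Implicit Defensive.

Import Order.TTheory GRing.Theory Num.Theory.
Local Open Scope ring_scope.

Definition posdefmx (R : realType) n (A : 'M[R]_n) : Prop :=
  A^T = A /\ forall x : 'cV[R]_n, x != 0 -> 0 < (x^T *m A *m x) 0 0.

Definition possemidefmx (R : realType) n (A : 'M[R]_n) : Prop :=
  A^T = A /\ forall x : 'cV[R]_n, 0 <= (x^T *m A *m x) 0 0.

(* Subsystems are numbered 1, ..., pb_N and times 0, ..., pb_T (or pb_T - 1);
   the families are total functions on nat whose values outside these ranges
   are irrelevant.  The predecessor's dimension n_(j-1) is [pb_n j.-1]; only
   for j = 1 does it refer to the meaningless n_0. *)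
Record problem (R : realType) := Problem {
  pb_N : nat;
  pb_T : nat;
  pb_n : nat -> nat;
  pb_m : nat -> nat;
  pb_nu : nat -> nat;
  pb_A : forall j : nat, nat -> 'M[R]_(pb_n j);
  pb_B : forall j : nat, nat -> 'M[R]_(pb_n j, pb_m j);
  pb_E : forall j : nat, nat -> 'M[R]_(pb_n j, pb_n j.-1);
  pb_Q : forall j : nat, nat -> 'M[R]_(pb_n j);
  pb_R : forall j : nat, nat -> 'M[R]_(pb_m j);
  pb_S : forall j : nat, nat -> 'M[R]_(pb_m j, pb_n j);
  pb_M : forall j : nat, nat -> 'M[R]_(pb_nu j, pb_n j);
  pb_L : forall j : nat, nat -> 'M[R]_(pb_nu j, pb_m j);
  pb_c : forall j : nat, nat -> 'cV[R]_(pb_nu j);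
  pb_xi : forall j : nat, 'cV[R]_(pb_n j)
}.

Definition problem_ok (R : realType) (P : problem R) : Prop :=
  [/\ (0 < pb_N P)%N,
      (0 < pb_T P)%N,
      forall t, (t < pb_T P)%N -> pb_E P 1 t = 0 &
      forall j, (1 <= j <= pb_N P)%N ->
        [/\ [/\ (0 < pb_n P j)%N, (0 < pb_m P j)%N & (0 < pb_nu P j)%N],
            forall t, (t < pb_T P)%N -> posdefmx (pb_R P j t),
            forall t, (t < pb_T P)%N ->
              possemidefmx (block_mx (pb_Q P j t) (pb_S P j t)^T
                                     (pb_S P j t) (pb_R P j t)),
            possemidefmx (pb_Q P j (pb_T P)) &
            pb_M P j 0 = 0]].

Lemma conform_mx_castmx (V : Type) m n m' n' (e : (m = m') * (n = n'))
  (B : 'M[V]_(m', n')) (A : 'M[V]_(m, n)) : conform_mx B A = castmx e A.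
Proof.
case: e B => em en; case: _ / em; case: _ / en => B.
by rewrite conform_mx_id.
Qed.

Section System.
Context {R : realType} (P : problem R).

Local Notation N := (pb_N P).
Local Notation T := (pb_T P).
Local Notation n := (pb_n P).
Local Notation m := (pb_m P).
Local Notation nu := (pb_nu P).

(* Stacked dimensions n_j (T+1), m_j T and nu_j (T+1), in the form that the
   \mxblock and \mxcol constructions produce. *)
Definition dimx j : nat := (\sum_(t < T.+1) n j)%N.
Definition dimu j : nat := (\sum_(t < T) m j)%N.
Definition dimc j : nat := (\sum_(t < T.+1) nu j)%N.

Definition sdim j : nat :=
  (dimx j + (dimu j + (dimx j + (dimc j + dimc j))))%N.

Definition Ahat j : 'M[R]_(dimx j) :=
  \mxblock_(t < T.+1, r < T.+1)
    (if t == r then 1%:M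
     else if t == r.+1 :> nat then - pb_A P j r else 0 : 'M[R]_(n j)).

Definition Ehat j : 'M[R]_(dimx j, dimx j.-1) :=
  \mxblock_(t < T.+1, r < T.+1)
    (if t == r.+1 :> nat then pb_E P j r else 0 : 'M[R]_(n j, n j.-1)).

Definition Bhat j : 'M[R]_(dimx j, dimu j) :=
  \mxblock_(t < T.+1, r < T)
    (if t == r.+1 :> nat then pb_B P j r else 0 : 'M[R]_(n j, m j)).

Definition Hhat j : 'M[R]_(dimx j, n j) :=
  \mxcol_(t < T.+1) (if t == 0 :> nat then 1%:M else 0 : 'M[R]_(n j)).

Definition Qhat j : 'M[R]_(dimx j) := \mxdiag_(t < T.+1) pb_Q P j t.

Definition Rhat j : 'M[R]_(dimu j) := \mxdiag_(t < T) pb_R P j t.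

Definition Shat j : 'M[R]_(dimu j, dimx j) :=
  \mxblock_(t < T, r < T.+1)
    (if t == r :> nat then pb_S P j t else 0 : 'M[R]_(m j, n j)).

Definition Mhat j : 'M[R]_(dimc j, dimx j) :=
  \mxblock_(t < T.+1, r < T.+1)
    (if t == r then pb_M P j t else 0 : 'M[R]_(nu j, n j)).

Definition Lhat j : 'M[R]_(dimc j, dimu j) :=
  \mxblock_(t < T.+1, r < T)
    (if t == r :> nat then pb_L P j t else 0 : 'M[R]_(nu j, m j)).

Definition chat j : 'cV[R]_(dimc j) := \mxcol_(t < T.+1) pb_c P j t.

Record iterate := Iterate {
  it_x : forall j : nat, 'cV[R]_(dimx j);
  it_u : forall j : nat, 'cV[R]_(dimu j);
  it_p : forall j : nat, 'cV[R]_(dimx j);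
  it_lam : forall j : nat, 'cV[R]_(dimc j);
  it_th : forall j : nat, 'cV[R]_(dimc j)
}.

Context (s : iterate) (sbar : R).

Definition svec j : 'cV[R]_(sdim j) :=
  col_mx (it_x s j) (col_mx (it_u s j) (col_mx (it_p s j)
    (col_mx (it_lam s j) (it_th s j)))).

Definition Lam j : 'M[R]_(dimc j) := diag_mx (it_lam s j)^T.
Definition Th j : 'M[R]_(dimc j) := diag_mx (it_th s j)^T.

Definition row5 (k a b c d e : nat) (Xa : 'M[R]_(k, a)) (Xb : 'M[R]_(k, b))
    (Xc : 'M[R]_(k, c)) (Xd : 'M[R]_(k, d)) (Xe : 'M[R]_(k, e)) :
    'M[R]_(k, a + (b + (c + (d + e)))) :=
  row_mx Xa (row_mx Xb (row_mx Xc (row_mx Xd Xe))).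

Definition Dmat j : 'M[R]_(sdim j) :=
  col_mx   (row5 (Qhat j)     (Shat j)^T (- (Ahat j)^T) (Mhat j)^T 0)
  (col_mx  (row5 (Shat j)     (Rhat j)   (Bhat j)^T     (Lhat j)^T 0)
  (col_mx  (row5 (- (Ahat j)) (Bhat j)   0              0          0)
  (col_mx  (row5 (Mhat j)     (Lhat j)   0              0          1%:M)
           (row5 0            0          0              (Th j)     (Lam j))))).

Definition Ups j : 'M[R]_(sdim j, sdim j.-1) :=
  col_mx   (row5 0            0          0              0          0)
  (col_mx  (row5 0            0          0              0          0)
  (col_mx  (row5 (- (Ehat j)) 0          0              0          0)
  (col_mx  (row5 0            0          0              0          0)
           (row5 0            0          0              0          0)))).

Definition mu : R :=
  (\sum_(1 <= j < N.+1) ((it_lam s j)^T *m it_th s j) 0 0)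
  / (\sum_(1 <= j < N.+1) nu j)%N%:R.

Definition sigma j : 'cV[R]_(dimc j) :=
  - (Th j *m it_lam s j) - Lam j *m it_th s j
  + Lam j *m Th j *m const_mx 1 - (sbar * mu) *: const_mx 1.

Definition rho j : 'cV[R]_(sdim j) :=
  - (if (1 < j)%N then Ups j *m svec j.-1 else 0)
  + Dmat j *m svec j
  - (if (j < N)%N then (Ups j.+1)^T *m svec j.+1 else 0)
  + col_mx 0 (col_mx 0 (col_mx (Hhat j *m pb_xi P j)
      (col_mx (chat j) (sigma j)))).

(* [Sigma_rec k j] performs [k] steps of the backward recursion so as to end
   at index [j], starting from D_(j+k); hence Sigma_j is obtained for
   k = N - j.  The defining equations are [SigmaN] and [Sigma_lt] below. *)
Fixpoint Sigma_rec (k j : nat) : 'M[R]_(sdim j) :=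
  if k is k'.+1 then
    Dmat j - (Ups j.+1)^T *m invmx (Sigma_rec k' j.+1) *m Ups j.+1
  else Dmat j.

Definition Sigma j : 'M[R]_(sdim j) := Sigma_rec (N - j) j.

Fixpoint rhot_rec (k j : nat) : 'cV[R]_(sdim j) :=
  if k is k'.+1 then
    rho j + (Ups j.+1)^T *m invmx (Sigma j.+1) *m rhot_rec k' j.+1
  else rho j.

Definition rhot j : 'cV[R]_(sdim j) := rhot_rec (N - j) j.

(* The value at index 0 is irrelevant. *)
Fixpoint delta (j : nat) : 'cV[R]_(sdim j) :=
  if j is i.+1 then
    invmx (Sigma i.+1) *m
      (if i == 0%N then rhot i.+1 else rhot i.+1 + Ups i.+1 *m delta i)
  else 0.

Lemma SigmaN : Sigma N = Dmat N.
Proof. by rewrite /Sigma subnn. Qed.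

Lemma Sigma_lt j : (j < N)%N ->
  Sigma j = Dmat j - (Ups j.+1)^T *m invmx (Sigma j.+1) *m Ups j.+1.
Proof. by move=> ltjN; rewrite {1}/Sigma -(subnSK ltjN). Qed.

Lemma rhotN : rhot N = rho N.
Proof. by rewrite /rhot subnn. Qed.

Lemma rhot_lt j : (j < N)%N ->
  rhot j = rho j + (Ups j.+1)^T *m invmx (Sigma j.+1) *m rhot j.+1.
Proof. by move=> ltjN; rewrite {1}/rhot -(subnSK ltjN). Qed.

Lemma delta1 : delta 1 = invmx (Sigma 1) *m rhot 1.
Proof. by []. Qed.

Lemma delta_gt1 j : (0 < j)%N ->
  delta j.+1 = invmx (Sigma j.+1) *m (rhot j.+1 + Ups j.+1 *m delta j).
Proof. by case: j. Qed.

(* The ordinals i, k : 'I_N stand for the subsystems i + 1 and k + 1.  In each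
   use of [conform_mx] the two dimensions agree under the guarding equality, so
   it is a mere transport and the default 0 is never selected. *)
Definition sysblock (i k : 'I_N) : 'M[R]_(sdim i.+1, sdim k.+1) :=
  if k == i then conform_mx 0 (Dmat i.+1)
  else if k == i.+1 :> nat then conform_mx 0 (- (Ups k.+1)^T)
  else if i == k.+1 :> nat then conform_mx 0 (- Ups i.+1)
  else 0.

Definition sysmx : 'M[R]_(\sum_(i < N) sdim i.+1) :=
  \mxblock_(i < N, k < N) sysblock i k.

Definition sysrhs : 'cV[R]_(\sum_(i < N) sdim i.+1) := \mxcol_(i < N) rho i.+1.

Definition syssol : 'cV[R]_(\sum_(i < N) sdim i.+1) := \mxcol_(i < N) delta i.+1.

Lemma sysblock_diag i : sysblock i i = Dmat i.+1.
Proof. by rewrite /sysblock eqxx conform_mx_id. Qed.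

Lemma sysblock_upper (i k : 'I_N) (e : k = i.+1 :> nat) :
  sysblock i k = castmx (congr1 sdim e, erefl) (- (Ups k.+1)^T).
Proof.
have ki : (k == i) = false by rewrite -val_eqE /= e gtn_eqF.
have ki1 : (k == i.+1 :> nat) = true by apply/eqP.
by rewrite /sysblock ki ki1 (conform_mx_castmx (congr1 sdim e, erefl)).
Qed.

Lemma sysblock_lower (i k : 'I_N) (e : i = k.+1 :> nat) :
  sysblock i k = castmx (erefl, congr1 sdim e) (- Ups i.+1).
Proof.
have ki : (k == i) = false by rewrite -val_eqE /= e ltn_eqF.
have ki1 : (k == i.+1 :> nat) = false by rewrite e ltn_eqF // leqW.
have ik1 : (i == k.+1 :> nat) = true by apply/eqP.
by rewrite /sysblock ki ki1 ik1 (conform_mx_castmx (erefl, congr1 sdim e)).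
Qed.

Lemma sysblock_far (i k : 'I_N) : k != i -> k != i.+1 :> nat ->
  i != k.+1 :> nat -> sysblock i k = 0.
Proof. by rewrite /sysblock; do 3!move=> /negPf->. Qed.

End System.

(* Main.v *)
(* Each Sigma_j is the matrix D_j with its block Q increased by a matrix E with
   x^T E x >= 0, and such a matrix K is invertible.  If
   K (x,u,p,l,t) = (0,0,y,0,0), pairing the first two rows with (x,u) gives
   q(x,u) + p.y = l.t <= 0, where q is the cost form and the sign comes from
   Theta l + Lambda t = 0.  For y = 0 this forces q(x,u) = 0, whence
   (x,u) = 0 by induction over time and then p = l = t = 0.  For general y it
   says that the (3,3) block of K^-1 is negative semidefinite, which is what
   carries the backward recursion one step further.  The linear system is then
   solved by block Gaussian elimination. *)
Require Import Defs.
From mathcomp Require Import all_boot all_order all_algebra.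
From mathcomp Require Import reals.
From mathcomp Require Import lra zify.

Set Implicit Arguments.
Unset Strict Implicit.
Unset Printing Implicit Defensive.

Import Order.TTheory GRing.Theory Num.Theory.
Local Open Scope ring_scope.

(** * Invertibility criterion and block vectors *)

Lemma unitmx_inj (F : fieldType) k (A : 'M[F]_k) :
  (forall v : 'cV_k, A *m v = 0 -> v = 0) -> A \in unitmx.
Proof.
move=> injA; rewrite -unitmx_tr -row_free_unit; apply: inj_row_free => v vA.
apply: trmx_inj; rewrite trmx0; apply: injA.
by rewrite -[A]trmxK -trmx_mul vA trmx0.
Qed.

(** Indexing the blocks by [nat], with the value 0 from [K] on, lets later arguments speak of
    [f t.+1] without carrying a bound. *)
Lemma mxcol_family_ex (V : nmodType) K (d : nat -> nat)
    (v : 'cV[V]_(\sum_(t < K) d t)) :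
  exists f : forall t, 'cV[V]_(d t), v = \mxcol_(t < K) f t.
Proof.
exists (fun t => if @idP (t < K)%N is ReflectT h then submxcol v (Ordinal h)
                 else 0).
apply/mxcolP => -[i iK]; rewrite mxcolK /=; case: {-}_ / idP => [h|//].
by rewrite (bool_irrelevance h iK).
Qed.

(** * Inner products and the quadratic cost form *)

Section Quadratic.
Context {R : realType}.

Definition dot k (u v : 'cV[R]_k) : R := (u^T *m v) 0 0.

Lemma dotC k (u v : 'cV[R]_k) : dot u v = dot v u.
Proof. by rewrite /dot -[v in LHS]trmxK -trmx_mul mxE. Qed.

Lemma dot_tr k l (A : 'M[R]_(k, l)) u v : dot u (A^T *m v) = dot v (A *m u).
Proof. by rewrite dotC /dot trmx_mul trmxK -mulmxA. Qed.

Lemma dotDr k (u v w : 'cV[R]_k) : dot u (v + w) = dot u v + dot u w.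
Proof. by rewrite /dot mulmxDr mxE. Qed.

Lemma dotNr k (u v : 'cV[R]_k) : dot u (- v) = - dot u v.
Proof. by rewrite /dot mulmxN mxE. Qed.

Lemma dot0r k (u : 'cV[R]_k) : dot u 0 = 0.
Proof. by rewrite /dot mulmx0 mxE. Qed.

Lemma dotE k (u v : 'cV[R]_k) : dot u v = \sum_i u i 0 * v i 0.
Proof. by rewrite /dot mxE; apply: eq_bigr => i _; rewrite mxE. Qed.

Lemma dot_mxcol K (k : 'I_K -> nat) (u v : forall t, 'cV[R]_(k t)) :
  dot (\mxcol_t u t) (\mxcol_t v t) = \sum_t dot (u t) (v t).
Proof. by rewrite /dot tr_mxcol mul_mxrow_mxcol summxE. Qed.

Definition qform a b (Q : 'M[R]_a) (S : 'M[R]_(b, a)) (W : 'M[R]_b) x u : R :=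
  dot x (Q *m x) + dot u (S *m x) *+ 2 + dot u (W *m u).

Lemma qform_block a b (Q : 'M[R]_a) (S : 'M[R]_(b, a)) (W : 'M[R]_b) x u :
  qform Q S W x u =
  ((col_mx x u)^T *m block_mx Q S^T S W *m col_mx x u) 0 0.
Proof.
rewrite -mulmxA mul_block_col tr_col_mx mul_row_col mxE -!/(dot _ _) !dotDr.
by rewrite dot_tr /qform mulr2n !addrA.
Qed.

Lemma qformDl a b (Q E : 'M[R]_a) (S : 'M[R]_(b, a)) (W : 'M[R]_b) x u :
  qform (Q + E) S W x u = qform Q S W x u + dot x (E *m x).
Proof.
by rewrite /qform mulmxDl dotDr -!addrA [dot x (E *m x) + _]addrC !addrA.
Qed.

End Quadratic.

(** * The KKT matrix of a single subsystem: invertibility and a sign for its inverse *)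

Section KKT.
Context {R : realType} (a b c : nat).

Definition kktmx (Q : 'M[R]_a) (S : 'M[R]_(b, a)) (W : 'M[R]_b) (A : 'M[R]_a)
    (B : 'M[R]_(a, b)) (M : 'M[R]_(c, a)) (L : 'M[R]_(c, b))
    (lam th : 'cV[R]_c) : 'M[R]_(a + (b + (a + (c + c)))) :=
  col_mx   (row5 Q     S^T (- A^T) M^T              0)
  (col_mx  (row5 S     W   B^T     L^T              0)
  (col_mx  (row5 (- A) B   0       0                0)
  (col_mx  (row5 M     L   0       0                1%:M)
           (row5 0     0   0       (diag_mx th^T) (diag_mx lam^T))))).

Context (S : 'M[R]_(b, a)) (W : 'M[R]_b) (A : 'M[R]_a) (B : 'M[R]_(a, b))
  (M : 'M[R]_(c, a)) (L : 'M[R]_(c, b)) (lam th : 'cV[R]_c)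
  (lam_ge0 : forall i, 0 <= lam i 0) (th_gt0 : forall i, 0 < th i 0).

Local Notation K Q := (kktmx Q S W A B M L lam th).

Definition col5 (x : 'cV[R]_a) (u : 'cV[R]_b) (p : 'cV[R]_a) (l t : 'cV[R]_c) :
    'cV[R]_(a + (b + (a + (c + c)))) :=
  col_mx x (col_mx u (col_mx p (col_mx l t))).

Lemma col5_surj v : exists x u p l t, v = col5 x u p l t.
Proof.
exists (usubmx v), (usubmx (dsubmx v)), (usubmx (dsubmx (dsubmx v))).
exists (usubmx (dsubmx (dsubmx (dsubmx v)))).
exists (dsubmx (dsubmx (dsubmx (dsubmx v)))).
by rewrite /col5 !vsubmxK.
Qed.

Lemma kkt_eqs Q x u p l t y : K Q *m col5 x u p l t = col5 0 0 y 0 0 ->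
  [/\ Q *m x + S^T *m u - A^T *m p + M^T *m l = 0,
      S *m x + W *m u + B^T *m p + L^T *m l = 0,
      - (A *m x) + B *m u = y,
      M *m x + L *m u + t = 0 &
      diag_mx th^T *m l + diag_mx lam^T *m t = 0].
Proof.
rewrite /kktmx /col5 !mul_col_mx /row5 !mul_row_col !mul0mx !mulNmx mul1mx.
rewrite !addr0 !add0r => /eq_col_mx[e1] /eq_col_mx[e2] /eq_col_mx[e3].
by move=> /eq_col_mx[e4 e5]; split; rewrite -?addrA.
Qed.

(** Entrywise, multiplying [l i * t i] by the positive [th i] gives [- lam i * t i ^ 2], which is
    nonpositive. *)
Lemma complementarity_le0 l t :
  diag_mx th^T *m l + diag_mx lam^T *m t = 0 -> dot l t <= 0.
Proof.
move=> e; rewrite dotE; apply: sumr_le0 => i _.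
have /matrixP/(_ i 0) := e; rewrite !mul_diag_mx !mxE => ei.
rewrite -(pmulr_rle0 _ (th_gt0 i)) mulrA.
have -> : th i 0 * l i 0 = - (lam i 0 * t i 0).
  by apply/eqP; rewrite -addr_eq0 ei.
by rewrite mulNr oppr_le0 -mulrA mulr_ge0// -expr2 sqr_ge0.
Qed.

(* Pairing the first two rows with [x] and [u] eliminates [p] and [l] up to the
   right-hand side [y] and the complementarity product. *)
Lemma kkt_energy Q x u p l t y : K Q *m col5 x u p l t = col5 0 0 y 0 0 ->
  qform Q S W x u + dot p y = dot l t.
Proof.
case/kkt_eqs=> e1 e2 <- e4 _.
have := congr1 (dot x) e1; have := congr1 (dot u) e2.
rewrite !dotDr !dotNr !dot0r !dot_tr /qform.
rewrite -[t]opprK -(addr0_eq e4) !dotNr !dotDr.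
lra.
Qed.

Lemma kkt_dual_le0 Q x u p l t y : (forall x u, 0 <= qform Q S W x u) ->
  K Q *m col5 x u p l t = col5 0 0 y 0 0 -> dot p y <= 0.
Proof.
move=> Q_ge0 e; have [_ _ _ _ /complementarity_le0] := kkt_eqs e.
have := Q_ge0 x u; have := kkt_energy e; lra.
Qed.

(** Definiteness of the cost is asked only along [A x = B u], which is what the third row of a
    kernel vector provides. *)
Lemma kkt_unit Q : (forall x u, 0 <= qform Q S W x u) -> A \in unitmx ->
  (forall x u, A *m x = B *m u -> qform Q S W x u = 0 -> x = 0 /\ u = 0) ->
  K Q \in unitmx.
Proof.
move=> Q_ge0 Au inj0; apply: unitmx_inj => v.
have [x [u [p [l [t ->]]]]] := col5_surj v.
have -> : 0 = col5 0 0 0 0 0 by rewrite /col5 !col_mx0.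
move=> e; have [e1 e2 e3 e4 e5] := kkt_eqs e.
have le_lt := complementarity_le0 e5.
have [x0 u0] : x = 0 /\ u = 0.
  apply: inj0; first by apply/esym/eqP; rewrite -subr_eq0 addrC e3.
  have := Q_ge0 x u; have := kkt_energy e; rewrite dot0r; lra.
(* Once [x] and [u] vanish, the fourth row gives [t = 0], the fifth [l = 0] because [th > 0], and
   the first [A^T p = 0]. *)
move: e1 e4 e5; rewrite x0 u0 !mulmx0 !add0r => e1 t0; move: e1.
rewrite t0 mulmx0 addr0 => e1 e5.
have l0 : l = 0.
  apply/matrixP=> i k; rewrite ord1 mxE.
  have /matrixP/(_ i 0) := e5; rewrite !mul_diag_mx !mxE => /eqP.
  by rewrite mulf_eq0 gt_eqF//= => /eqP.
move: e1; rewrite l0 mulmx0 addr0 => /eqP; rewrite oppr_eq0 => /eqP e1.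
have Atu : A^T \in unitmx by rewrite unitmx_tr.
have p0 : p = 0 by rewrite -[p](mulKmx Atu) e1 mulmx0.
by rewrite p0.
Qed.

(** Embeddings of the first and third blocks: the coupling matrices factor through them, so a Schur
    complement touches only the block [Q]. *)
Definition inj1 : 'M[R]_(a + (b + (a + (c + c))), a) := col_mx 1%:M 0.
Definition inj3 : 'M[R]_(a + (b + (a + (c + c))), a) :=
  col_mx 0 (col_mx 0 (col_mx 1%:M 0)).

Lemma kktD Q E : K (Q + E) = K Q + inj1 *m E *m inj1^T.
Proof.
rewrite /inj1 mul_col_mx mul1mx mul0mx tr_col_mx trmx1 trmx0 mul_col_row.
rewrite !mulmx0 !mul0mx mulmx1 /block_mx /kktmx /row5 add_col_mx add_row_mx.
by rewrite !row_mx0 !addr0.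
Qed.

(** Solving with right-hand side [y] in the third row, the third block of the solution is [p], so
    the form at [y] equals [dot p y]. *)
Lemma kkt_inv33 Q y : (forall x u, 0 <= qform Q S W x u) -> K Q \in unitmx ->
  dot y (inj3^T *m invmx (K Q) *m inj3 *m y) <= 0.
Proof.
move=> Q_ge0 Ku; rewrite -!mulmxA; set v := invmx _ *m _.
have e : K Q *m v = inj3 *m y by rewrite mulKVmx.
have inj3E : inj3 *m y = col5 0 0 y 0 0.
  by rewrite /inj3 /col5 !mul_col_mx !mul0mx mul1mx col_mx0.
have [x [u [p [l [t vE]]]]] := col5_surj v.
move: e; rewrite dot_tr inj3E vE => /(kkt_dual_le0 Q_ge0).
by rewrite /col5 /dot !tr_col_mx !mul_row_col !mulmx0 !addr0 !add0r.
Qed.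

End KKT.

(** * Sums selecting a single index *)

Lemma sum_if_ord (V : nmodType) K k (F : nat -> V) :
  \sum_(r < K) (if k == r :> nat then F r else 0) =
  if (k < K)%N then F k else 0.
Proof.
rewrite -big_mkcond -[RHS](big_ord1_eq +%R) /=.
by apply: eq_bigl => i; rewrite eq_sym.
Qed.

Lemma sum_if_ordS (V : nmodType) K t (F : nat -> V) : (t <= K)%N ->
  \sum_(r < K) (if t == r.+1 :> nat then F r else 0) =
  if t is t'.+1 then F t' else 0.
Proof.
case: t => [|t] tK; first by rewrite big1.
by under eq_bigr do rewrite eqSS; rewrite sum_if_ord tK.
Qed.

Lemma mulmx_if (R : pzSemiRingType) a b c (e : bool) (A B : 'M[R]_(a, b))
    (C : 'M[R]_(b, c)) :
  (if e then A else B) *m C = if e then A *m C else B *m C.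
Proof. by case: e. Qed.

(** * Stacked matrices as dynamics and stage costs over time *)

Section Dynamics.
Context {R : realType} (P : problem R).
Local Notation T := (pb_T P).
Local Notation n := (pb_n P).
Local Notation m := (pb_m P).

Lemma Ahat_mxcol j (x : nat -> 'cV[R]_(n j)) :
  Ahat P j *m \mxcol_(t < T.+1) x t =
  \mxcol_(t < T.+1) (x t - if t : nat is t'.+1 then pb_A P j t' *m x t' else 0).
Proof.
rewrite mul_mxblock_mxrow; apply: eq_mxcol => t.
(* The diagonal and subdiagonal conditions exclude each other, so each block splits into two
   independent selections. *)
transitivity (\sum_(r < T.+1) (if t == r :> nat then x r else 0)
   - \sum_(r < T.+1) (if t == r.+1 :> nat then pb_A P j r *m x r else 0)).
  rewrite -sumrB; apply: eq_bigr => r _; rewrite !mulmx_if mul1mx mul0mx mulNmx.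
  rewrite -val_eqE /=; case: eqVneq => [->|_]; first by rewrite ltn_eqF// subr0.
  by rewrite sub0r; case: eqP => _; rewrite ?oppr0.
rewrite sum_if_ord ltn_ord (sum_if_ordS (fun r => pb_A P j r *m x r))//.
exact: ltnW.
Qed.

Lemma Bhat_mxcol j (u : nat -> 'cV[R]_(m j)) :
  Bhat P j *m \mxcol_(t < T) u t =
  \mxcol_(t < T.+1) (if t : nat is t'.+1 then pb_B P j t' *m u t' else 0).
Proof.
rewrite mul_mxblock_mxrow; apply: eq_mxcol => t.
under eq_bigr do rewrite mulmx_if mul0mx.
by rewrite (sum_if_ordS (fun r => pb_B P j r *m u r)) // -ltnS.
Qed.

Lemma Shat_mxcol j (x : nat -> 'cV[R]_(n j)) :
  Shat P j *m \mxcol_(t < T.+1) x t = \mxcol_(t < T) (pb_S P j t *m x t).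
Proof.
rewrite mul_mxblock_mxrow; apply: eq_mxcol => t.
under eq_bigr do rewrite mulmx_if mul0mx.
by rewrite (sum_if_ord _ _ (fun r => pb_S P j t *m x r)) ltnS ltnW.
Qed.

Lemma dynamics j (x : nat -> 'cV[R]_(n j)) (u : nat -> 'cV[R]_(m j)) :
  Ahat P j *m \mxcol_(t < T.+1) x t = Bhat P j *m \mxcol_(t < T) u t ->
  x 0 = 0 /\
  forall t, (t < T)%N -> x t.+1 = pb_A P j t *m x t + pb_B P j t *m u t.
Proof.
rewrite Ahat_mxcol Bhat_mxcol => /eq_mxcolP e; split.
  by have := e ord0; rewrite subr0.
move=> t tT; have := e (Ordinal (tT : (t.+1 < T.+1)%N)) => /= /eqP.
by rewrite subr_eq addrC => /eqP.
Qed.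

Lemma Ahat_unit j : Ahat P j \in unitmx.
Proof.
apply: unitmx_inj => v; have [x ->] := mxcol_family_ex (d := fun=> _) v => Ax.
(* A kernel vector is a trajectory with zero input started at 0. *)
have [|x0 xS] := @dynamics j x (fun=> 0); first by rewrite Ax mxcol0 mulmx0.
have {}x0 t : (t <= T)%N -> x t = 0.
  elim: t => // t IH tT; rewrite xS// IH ?(ltnW tT)// !mulmx0 addr0 //.
by rewrite -[RHS]mxcol0; apply: eq_mxcol => t; rewrite x0// -ltnS.
Qed.

Definition stage j t := qform (pb_Q P j t) (pb_S P j t) (pb_R P j t).

(** The input has [T] blocks and the state [T + 1], so time [T] contributes a pure state cost. *)
Lemma qform_hat j (x : nat -> 'cV[R]_(n j)) (u : nat -> 'cV[R]_(m j)) :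
  qform (Qhat P j) (Shat P j) (Rhat P j)
    (\mxcol_(t < T.+1) x t) (\mxcol_(t < T) u t) =
  \sum_(t < T) stage t (x t) (u t) + dot (x T) (pb_Q P j T *m x T).
Proof.
rewrite /qform Shat_mxcol !mul_mxdiag_mxcol !dot_mxcol big_ord_recr /=.
rewrite /stage /qform !big_split /= -sumrMnl -!addrA; congr (_ + _).
by rewrite sumrMnl mulr2n addrC -!addrA.
Qed.

Context (hP : problem_ok P) (j : nat) (jN : (1 <= j <= pb_N P)%N).

Lemma stage_ge0 t x u : (t < T)%N -> 0 <= stage (j := j) t x u.
Proof.
move=> tT; case: hP => _ _ _ /(_ j jN)[_ _ /(_ t tT)[_ QS_ge0] _ _].
by rewrite /stage qform_block QS_ge0.
Qed.

Lemma qform_hat_ge0 x u : 0 <= qform (Qhat P j) (Shat P j) (Rhat P j) x u.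
Proof.
have [xs ->] := mxcol_family_ex (d := fun=> _) x.
have [us ->] := mxcol_family_ex (d := fun=> _) u.
rewrite qform_hat addr_ge0 ?sumr_ge0// => [t _|]; first exact: stage_ge0.
by case: hP => _ _ _ /(_ j jN)[_ _ _ [_ QT_ge0] _]; rewrite /dot mulmxA QT_ge0.
Qed.

(* The stage costs need not be definite in [(x, u)], but [x 0 = 0]; forward in
   time, a vanishing [x t] reduces the stage cost to the definite [R]-term,
   which forces [u t = 0] and then [x t.+1 = 0]. *)
Lemma qform_hat_eq0 x u : Ahat P j *m x = Bhat P j *m u ->
  qform (Qhat P j) (Shat P j) (Rhat P j) x u = 0 -> x = 0 /\ u = 0.
Proof.
have [xs ->] := mxcol_family_ex (d := fun=> _) x.
have [us ->] := mxcol_family_ex (d := fun=> _) u.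
move=> /dynamics[x0 xS]; rewrite qform_hat => /eqP.
have sge0 : 0 <= \sum_(t < T) stage t (xs t) (us t).
  by apply: sumr_ge0 => t _; exact: stage_ge0.
case: (hP) => _ _ _ /(_ j jN)[_ Rpos _ [_ QT_ge0] _].
rewrite paddr_eq0//; last by rewrite /dot mulmxA QT_ge0.
rewrite psumr_eq0 => [/andP[/allP s0 _]|t _]; last exact: stage_ge0.
have u0 t : (t < T)%N -> xs t = 0 -> us t = 0.
  move=> tT xt0; have /eqP := s0 (Ordinal tT) (mem_index_enum _).
  rewrite /stage /qform /= xt0 !mulmx0 !dot0r mul0rn !add0r => e.
  apply/eqP/negPn/negP => /(proj2 (Rpos t tT) _).
  by rewrite -mulmxA -/(dot _ _) e ltxx.
have xs0 t : (t <= T)%N -> xs t = 0.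
  elim: t => // t IH tT; have xt0 := IH (ltnW tT).
  by rewrite xS// xt0 u0// !mulmx0 addr0.
split; rewrite -[RHS]mxcol0; apply: eq_mxcol => t; first by rewrite xs0// -ltnS.
by rewrite u0// xs0// ltnW.
Qed.

End Dynamics.

(** * Block Gaussian elimination on the tridiagonal system *)

Section Elimination.
Context {R : realType} (P : problem R) (s : iterate P) (sbar : R).
Local Notation N := (pb_N P).
Local Notation Dj := (Dmat s).
Local Notation U := (Ups P).

Definition from_pred (y : forall j, 'cV[R]_(sdim P j)) j : 'cV[R]_(sdim P j) :=
  if (1 < j)%N then U j *m y j.-1 else 0.

(** Families over [nat] make the types of neighbouring blocks match by computation, which removes
    the transports of [sysblock]. *)
Definition tridiag_row (y : forall j, 'cV[R]_(sdim P j)) j :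
    'cV[R]_(sdim P j) :=
  Dj j *m y j - from_pred y j - (if (j < N)%N then (U j.+1)^T *m y j.+1 else 0).

Lemma sysmx_row (y : forall j, 'cV[R]_(sdim P j)) (i : 'I_N) :
  submxcol (sysmx s *m \mxcol_(k < N) y k.+1) i = tridiag_row y i.+1.
Proof.
rewrite mul_mxblock_mxrow mxcolK /tridiag_row /from_pred /=.
have rowE (k : 'I_N) : sysblock s i k *m y k.+1 =
    (if i == k :> nat then Dj i.+1 *m y i.+1 else 0)
  - (if i == k.+1 :> nat then U i.+1 *m y i else 0)
  - (if i.+1 == k :> nat then (U i.+2)^T *m y i.+2 else 0).
  case: eqVneq => [/val_inj <-|ik].
    by rewrite sysblock_diag ltn_eqF// gtn_eqF// !subr0.
  case: eqVneq => [ik1|ik1].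
    rewrite (sysblock_lower s ik1) gtn_eqF ?ik1//.
    (* Substituting the index turns the equality proof inside [castmx] into [erefl], and the cast
       disappears. *)
    by case: i ik ik1 => i /= iN _ ik1; subst i; rewrite mulNmx sub0r subr0.
  case: eqVneq => [ki1|ki1].
    rewrite (sysblock_upper s (esym ki1)).
    case: k ik ik1 ki1 => k /= kN _ _ ki1; subst k.
    by rewrite mulNmx subr0 sub0r.
  by rewrite sysblock_far ?mul0mx ?subr0// eq_sym.
under eq_bigr do rewrite rowE.
rewrite !sumrB (sum_if_ord _ _ (fun=> Dj i.+1 *m y i.+1)) ltn_ord.
rewrite (sum_if_ordS (fun=> U i.+1 *m y i)) ?(ltnW (ltn_ord i))//.
rewrite (sum_if_ord _ _ (fun=> (U i.+2)^T *m y i.+2)).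
by case: (val i).
Qed.

Lemma tridiag_last y : tridiag_row y N = rho s sbar N <->
  Sigma s N *m y N = rhot s sbar N + from_pred y N.
Proof.
rewrite SigmaN rhotN /tridiag_row ltnn subr0.
by split=> [<-|->]; rewrite ?subrK ?addrK.
Qed.

(** After substituting [y j.+1] into row [j], its part in [y j] merges with [Dmat] into [Sigma] and
    the rest with [rho] into [rhot]. Being an equivalence, this serves both existence and
    uniqueness. *)
Lemma tridiag_elim y j : (0 < j < N)%N ->
  y j.+1 = invmx (Sigma s j.+1) *m (rhot s sbar j.+1 + U j.+1 *m y j) ->
  tridiag_row y j = rho s sbar j <->
  Sigma s j *m y j = rhot s sbar j + from_pred y j.
Proof.
case/andP=> j0 jN e; rewrite /tridiag_row jN e.
rewrite (Sigma_lt s jN) (rhot_lt s sbar jN).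
rewrite mulmxBl !mulmxDr !mulmxA.
set a := Dj j *m _; set b := from_pred _ _; set c := _ *m rhot _ _ _.
set d := _ *m y j.
split=> h.
  by rewrite -h opprD addrA [_ - d + c]addrAC subrK addrAC subrK.
by rewrite opprD addrA addrAC (addrAC a) h !addrK.
Qed.

Section Uniqueness.
Context (Sigma_unit : forall j, (1 <= j <= N)%N -> Sigma s j \in unitmx).

Lemma tridiag_bwd y :
  (forall j, (1 <= j <= N)%N -> tridiag_row y j = rho s sbar j) ->
  forall j, (1 <= j <= N)%N ->
    y j = invmx (Sigma s j) *m (rhot s sbar j + from_pred y j).
Proof.
(* Induction on [N - j]: the formula at [j.+1] is the hypothesis of the elimination at [j]. *)
move=> rows j; have [k] := ubnP (N - j); elim: k j => // k IH j kNj jN.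
suff <- : Sigma s j *m y j = rhot s sbar j + from_pred y j.
  by rewrite mulKmx// Sigma_unit.
have /andP[j0] := jN; rewrite leq_eqVlt => /orP[/eqP jEN|ltjN].
  by move: (rows j jN); rewrite jEN; apply tridiag_last.
apply/tridiag_elim; rewrite ?j0 ?rows//.
rewrite [LHS]IH//; last by rewrite subnS -ltnS prednK ?subn_gt0.
by rewrite /from_pred ltnS j0.
Qed.

Lemma delta_bwd j : (0 < j)%N ->
  delta s sbar j =
  invmx (Sigma s j) *m (rhot s sbar j + from_pred (delta s sbar) j).
Proof. by case: j => [|[|j]]//= _; rewrite addr0. Qed.

(** Both families obey the same forward formula, which determines each entry from its predecessor
    and the first entry outright. *)
Lemma tridiag_uniq y :
  (forall j, (1 <= j <= N)%N -> tridiag_row y j = rho s sbar j) ->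
  forall j, (1 <= j <= N)%N -> y j = delta s sbar j.
Proof.
move=> /tridiag_bwd yE; elim=> // j IH jN.
rewrite yE// delta_bwd// /from_pred; case: ltnP => // j0.
by rewrite /= IH// -ltnS j0/= ltnW.
Qed.

Lemma tridiag_delta j : (1 <= j <= N)%N ->
  tridiag_row (delta s sbar) j = rho s sbar j.
Proof.
move=> jN; have /andP[j0] := jN.
have h : Sigma s j *m delta s sbar j =
    rhot s sbar j + from_pred (delta s sbar) j.
  by rewrite delta_bwd// mulKVmx// Sigma_unit.
rewrite leq_eqVlt => /orP[/eqP jEN|ltjN].
  by move: h; rewrite jEN => h; apply/tridiag_last.
by apply/tridiag_elim; rewrite ?j0// delta_gt1.
Qed.

Lemma sysmx_syssol : sysmx s *m syssol s sbar = sysrhs s sbar.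
Proof.
by apply/mxcolP => i; rewrite sysmx_row mxcolK tridiag_delta//=.
Qed.

Lemma syssol_uniq x : sysmx s *m x = sysrhs s sbar -> x = syssol s sbar.
Proof.
have [f ->] := mxcol_family_ex (d := fun i => sdim P i.+1) x.
(* Shift to numbering from 1; the filler at index 0 is never read, thanks to the guard in
   [from_pred]. *)
pose y j : 'cV[R]_(sdim P j) := if j is i.+1 then f i else 0.
rewrite -[\mxcol_i f i]/(\mxcol_(i < N) y i.+1) => /mxcolP e.
apply: eq_mxcol => i; apply: tridiag_uniq; last by rewrite /= ltn_ord.
case=> [//|j]/= jN.
by have := e (Ordinal jN); rewrite sysmx_row mxcolK.
Qed.

End Uniqueness.
End Elimination.

(** * Invertibility of every matrix in the backward recursion *)

Section Nonsingular.
Context {R : realType} (P : problem R) (s : iterate P).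
Local Notation N := (pb_N P).
Context (hP : problem_ok P)
  (hlam : forall j, (1 <= j <= N)%N -> forall i, 0 <= it_lam s j i 0)
  (hth : forall j, (1 <= j <= N)%N -> forall i, 0 < it_th s j i 0).

Definition Dpert j (E : 'M[R]_(dimx P j)) : 'M[R]_(sdim P j) :=
  kktmx (Qhat P j + E) (Shat P j) (Rhat P j) (Ahat P j) (Bhat P j)
    (Mhat P j) (Lhat P j) (it_lam s j) (it_th s j).

Lemma Dpert0 j : Dpert (j := j) 0 = Dmat s j.
Proof. by rewrite /Dpert addr0. Qed.

Lemma Ups_inj j : Ups P j = - (inj3 _ _ _ *m Ehat P j *m (inj1 _ _ _)^T).
Proof.
rewrite /inj1 /inj3 tr_col_mx trmx1 trmx0 !mul_col_mx !mul0mx mul1mx.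
rewrite mul_mx_row mulmx1 mulmx0 /Ups /row5 !opp_col_mx opp_row_mx !oppr0.
by rewrite !row_mx0 !col_mx0.
Qed.

Section Fixed.
Context (j : nat) (jN : (1 <= j <= N)%N) (E : 'M[R]_(dimx P j))
  (E_ge0 : forall x, 0 <= dot x (E *m x)).

Lemma qform_pert_ge0 x u :
  0 <= qform (Qhat P j + E) (Shat P j) (Rhat P j) x u.
Proof. by rewrite qformDl addr_ge0 ?qform_hat_ge0. Qed.

Lemma Dpert_unit : Dpert E \in unitmx.
Proof.
apply: kkt_unit;
  [exact: hlam|exact: hth|exact: qform_pert_ge0|exact: Ahat_unit|].
move=> x u Axu /eqP; rewrite qformDl paddr_eq0 ?qform_hat_ge0//.
by case/andP=> /eqP q0 _; apply: (qform_hat_eq0 hP jN).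
Qed.

(** With [z = F x] the form equals [- dot z (G z)], and [G] is the (3,3) block of the inverse. *)
Lemma schur_term_ge0 k (F : 'M[R]_(dimx P j, dimx P k))
    (x : 'cV[R]_(dimx P k)) :
  let G := (inj3 _ _ _)^T *m invmx (Dpert E) *m inj3 _ _ _ in
  0 <= dot x (- (F^T *m G *m F) *m x).
Proof.
rewrite /= mulNmx dotNr oppr_ge0 -!mulmxA dot_tr dotC !mulmxA -!(mulmxA _ F).
apply: kkt_inv33;
  [exact: hlam|exact: hth|exact: qform_pert_ge0|exact: Dpert_unit].
Qed.

End Fixed.

Lemma Sigma_rec_pert k j : (1 <= j)%N -> (j + k)%N = N ->
  exists2 E, Sigma_rec s k j = Dpert (j := j) E & forall x, 0 <= dot x (E *m x).
Proof.
elim: k j => [|k IH] j j0 jk /=.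
  by exists 0; rewrite ?Dpert0// => x; rewrite mul0mx dot0r.
have [E -> E_ge0] := IH j.+1 isT (etrans (addSnnS j k) jk).
have jN : (1 <= j.+1 <= N)%N by rewrite /= -jk addnS ltnS leq_addr.
(* The new perturbation is [- Ehat^T G Ehat], with [G] the (3,3) block of the inverse of the next
   [Sigma]; the two minus signs of [Ups] cancel. *)
eexists; last exact: (schur_term_ge0 jN E_ge0 (Ehat P j.+1)).
rewrite [RHS]kktD -/(Dmat s j).
rewrite Ups_inj [(- _)^T]linearN/= !(mulNmx, mulmxN) opprK.
by rewrite !trmx_mul trmxK !mulmxA.
Qed.

Lemma Sigma_unit j : (1 <= j <= N)%N -> Sigma s j \in unitmx.
Proof.
move=> jN; have /andP[j0 ltjN] := jN.
have [E SE E_ge0] := Sigma_rec_pert j0 (subnKC ltjN).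
by rewrite /Sigma SE Dpert_unit.
Qed.

End Nonsingular.

(** * Dimension count and conclusion *)

Lemma sdimE (R : realType) (P : problem R) j :
  sdim P j = ((2 * pb_n P j + 2 * pb_nu P j) * (pb_T P).+1
             + pb_m P j * pb_T P)%N.
Proof. by rewrite /sdim /dimx /dimu /dimc !sum_nat_const !card_ord; lia. Qed.

Theorem lemma1 (R : realType) (P : problem R) (s : iterate P) (sbar : R)
    (hP : problem_ok P)
    (hlam : forall j, (1 <= j <= pb_N P)%N ->
              forall i, 0 <= it_lam s j i 0)
    (hth : forall j, (1 <= j <= pb_N P)%N ->
              forall i, 0 < it_th s j i 0)
    (hsbar : 0 < sbar < 1) :
  [/\ forall j, (1 <= j <= pb_N P)%N ->
        sdim P j = ((2 * pb_n P j + 2 * pb_nu P j) * (pb_T P).+1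
                   + pb_m P j * pb_T P)%N
        /\ Sigma s j \in unitmx,
      sysmx s *m syssol s sbar = sysrhs s sbar &
      forall x : 'cV[R]_(\sum_(i < pb_N P) sdim P i.+1),
        sysmx s *m x = sysrhs s sbar -> x = syssol s sbar].
Proof.
split.
- by move=> j jN; split; [exact: sdimE|exact: Sigma_unit hP hlam hth _ jN].
- exact: sysmx_syssol (Sigma_unit hP hlam hth).
- exact: syssol_uniq (Sigma_unit hP hlam hth).
Qed.
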